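(* Any (possibly randomized and adaptive) algorithm that, given as input $\varepsilon,\delta\in(0,1)$ and access to a $\mathrm{maxsample}$ oracle for any MNL $M$ supported on $[n]$, outputs an MNL $\hat M$ satisfying $\Pr[d_\infty(M,\hat M)\le\varepsilon]\ge1-\delta$, must make $\Omega\left(\frac{n}{\varepsilon^2}\log\frac{n}{\delta}\right)$ queries in the worst case.
   Context: A multinomial logit model (MNL) $M$ supported on $[n]=\{1,\dots,n\}$ is given by positive weights $w_1,\dots,w_n>0$; for every non-empty $S\subseteq[n]$ it induces the distribution $M_S$ on $S$ with $M_S(i)=w_i/\sum_{j\in S}w_j$. A $\mathrm{maxsample}$ oracle for $M$, given a non-empty slate $S\subseteq[n]$ (of any size), returns an item of $S$ drawn from $M_S$, independently across queries; each call counts as one query. $d_\infty(M,M')=\max_{\emptyset\neq S\subseteq[n]}\|M_S-M'_S\|_\infty$. *)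

(* Defs.v *)
From HB Require Import structures.
From mathcomp Require Import all_boot all_order all_algebra.
From mathcomp Require Import all_classical all_reals all_analysis.

Set Implicit Arguments.
Unset Strict Implicit.
Unset Printing Implicit Defensive.
Import Order.TTheory GRing.Theory Num.Theory.
Import numFieldNormedType.Exports.
Local Open Scope classical_set_scope.
Local Open Scope ring_scope.

Definition slate (n : nat) := {S : {set 'I_n} | (0 < #|S|)%N}.

Record mnl (R : realType) (n : nat) := MNL {
  weight : 'I_n -> R ;
  weight_gt0 : forall i, 0 < weight i }.

Definition choice_prob (R : realType) (n : nat) (M : mnl R n)
    (S : {set 'I_n}) (i : 'I_n) : R :=
  if i \in S then weight M i / \sum_(j in S) weight M j else 0.

Definition d_infty (R : realType) (n : nat) (M M' : mnl R n) : R :=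
  \big[Num.max/0]_(S : slate n) \big[Num.max/0]_(i in val S)
    `|choice_prob M (val S) i - choice_prob M' (val S) i|.

Inductive action (R : realType) (n : nat) :=
  | Query of slate n
  | Output of mnl R n.

(* The value 0 encodes "not an output": the weights of an MNL are positive. *)
Definition out_weight (R : realType) (n : nat) (a : action R n) (i : 'I_n) : R :=
  if a is Output M then weight M i else 0.

(* [step h w] is the next step of the algorithm with internal randomness [w]
   after the oracle answers [h], oldest first. The earlier slates need not be
   recorded in the history: they are functions of [w] and of prefixes of [h]. *)
Record algorithm (R : realType) (n : nat) (d : measure_display)
    (Omega : measurableType d) := Algorithm {
  step : seq 'I_n -> Omega -> action R n ;
  measurable_query : forall (h : seq 'I_n) (S : slate n),
    measurable [set w | step h w = Query R S] ;
  measurable_output : forall (h : seq 'I_n) (i : 'I_n),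
    measurable_fun setT (fun w => out_weight (step h w) i) }.

Section Run.
Context (R : realType) (n : nat) (d : measure_display)
  (Omega : measurableType d) (P : probability Omega R)
  (A : algorithm R n Omega) (M : mnl R n).

Definition answer_prob (a : action R n) (i : 'I_n) : R :=
  if a is Query Q then choice_prob M (val Q) i else 0.

(* Conditionally on [w], the probability that at least [k] queries are made and
   that the first [k] answers are [h]. The maxsample oracle uses fresh
   randomness, independent of [w], at each call: hence the product. *)
Definition transcript_prob (k : nat) (h : k.-tuple 'I_n) (w : Omega) : R :=
  \prod_(t < k) answer_prob (step A (take t h) w) (tnth h t).

Definition prob_queries_ge (k : nat) : \bar R :=
  (\int[P]_w (\sum_(h : k.-tuple 'I_n) transcript_prob h w)%:E)%E.

Definition accurate (eps : R) (a : action R n) : bool :=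
  if a is Output M' then d_infty M M' <= eps else false.

(* Sum over the number [k] of queries made before the output; runs that never
   output anything do not contribute. *)
Definition prob_accurate (eps : R) : \bar R :=
  (\int[P]_w \sum_(0 <= k <oo)
     (\sum_(h : k.-tuple 'I_n | accurate eps (step A h w))
        transcript_prob h w)%:E)%E.

End Run.

(* Main.v *)
(* Cut [n] into [B = n %/ m] blocks of [m] items and plant in each block one
   special item of weight [1 + kappa], all other weights being 1. On the slate
   of a block, an output gives some item probability at most [1/m], so it is
   not accurate for any hypothesis [theta] having that item as its special one:
   an output accurate for [theta] becomes wrong for [B] hypotheses, one per
   block, each obtained from [theta] by moving one special item. Conversely, a
   hypothesis for which an output is wrong arises in at most [m] ways as such a
   move of a hypothesis for which it is right. Hence the likelihoods of the [B]
   moves, averaged over [theta] and summed over the successful transcripts, sum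
   up to at most [m delta].
   On the other hand, the average over [B] of these likelihoods is at least the
   likelihood under [theta] divided by a product, along the transcript, of
   averages of one-step likelihood ratios (the harmonic mean is at most the
   geometric mean, which is at most the arithmetic mean). This product has
   expectation at most [(1 + K / B) ^ N] after [N] queries, where
   [K = O(kappa ^ 2)], whatever slates are queried. By AM-GM,
   [(1 - delta) ^ 2 * B <= m * delta * (1 + K / B) ^ N], which is the bound.
   For small [eps], take [m = 2] and [kappa = 8 * eps]. For [eps] bounded away
   from 0, any constant [K] will do, and [m] and [kappa] are chosen large enough
   for [eps1 < 1] to be below the gap [(1 + kappa) / (m + kappa) - 1 / m]. *)
Require Import Defs.
From mathcomp Require Import all_boot all_order all_algebra.
From mathcomp Require Import all_classical all_reals all_analysis.
From mathcomp Require Import measurable_realfun zify ring lra.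
Import Order.TTheory GRing.Theory Num.Theory.
Import numFieldNormedType.Exports.
Local Open Scope classical_set_scope.
Local Open Scope ring_scope.

(** * Trees of transcripts *)

Lemma big_tuple_cons {V : nmodType} {I : finType} (k : nat)
    (P : pred (seq I)) (F : k.+1.-tuple I -> V) :
  \sum_(h : k.+1.-tuple I | P h) F h =
  \sum_i \sum_(h : k.-tuple I | P (i :: h)) F [tuple of i :: h].
Proof.
rewrite (pair_big_dep predT (fun i (h : k.-tuple I) => P (i :: h))
  (fun i (h : k.-tuple I) => F [tuple of i :: h])) /=.
apply: (reindex (fun u : I * k.-tuple I => [tuple of u.1 :: u.2])).
exists (fun t : k.+1.-tuple I => (thead t, [tuple of behead t])) => [[x t] _|t _] /=.
  by congr pair; apply/val_inj.
by rewrite [in RHS](tuple_eta t).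
Qed.

Lemma big_tuple0 {V : nmodType} {I : finType}
    (P : pred (seq I)) (F : 0.-tuple I -> V) :
  \sum_(h : 0.-tuple I | P h) F h = if P [::] then F [tuple] else 0.
Proof.
rewrite (eq_bigl (fun h : 0.-tuple I => (h == [tuple]) && P [::])); last first.
  by move=> h; case: eqP => [->//|]; rewrite (tuple0 h).
by rewrite big_mkcondr big_pred1_eq.
Qed.

(** Both sides are raised to the power [B]. AM-GM over [b] is then applied twice: to the inverse
    products, and to the factors at each fixed [t]. *)
Lemma harmonic_le_prod_mean {R : realType} {B k : nat} {x : 'I_B -> 'I_k -> R} :
  (0 < B)%N -> (forall b t, 0 < x b t) ->
  (\prod_t ((\sum_b x b t) / B%:R))^-1 <= (\sum_b (\prod_t x b t)^-1) / B%:R.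
Proof.
move=> B0 x0.
have X0 b : 0 < \prod_t x b t by apply: prodr_gt0.
have BR : (0 : R) < B%:R by rewrite ltr0n.
have mean_gt0 t : 0 < (\sum_b x b t) / B%:R.
  rewrite divr_gt0 //.
  case: B B0 x x0 {X0 BR} => // B _ x x0.
  by rewrite big_ord_recl ltr_pwDl // sumr_ge0 // => b _; exact: ltW.
have Y0 : 0 < \prod_t ((\sum_b x b t) / B%:R) by apply: prodr_gt0.
have S0 : 0 <= (\sum_b (\prod_t x b t)^-1) / B%:R.
  by rewrite divr_ge0 ?ler0n// sumr_ge0// => b _; rewrite invr_ge0 ltW.
rewrite -(@ler_pXn2r _ B)// ?nnegrE ?invr_ge0 ?(ltW Y0)//.
have /= := @leif_AGM _ 'I_B predT (fun b => (\prod_t x b t)^-1).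
rewrite cardT size_enum_ord => /(_ _)[|+ _]; first by move=> b _; rewrite invr_ge0 ltW.
apply: le_trans; rewrite exprVn prodfV lef_pV2 ?posrE ?exprn_gt0 ?prodr_gt0//.
rewrite -prodrXl exchange_big /=; apply: ler_prod => t _.
rewrite prodr_ge0 /= => [|b _]; last exact: ltW.
have /= := @leif_AGM _ 'I_B predT (fun b => x b t).
by rewrite cardT size_enum_ord => /(_ _)[|//]; move=> b _; exact: ltW.
Qed.

Definition is_output {R : realType} {n : nat} (a : action R n) : bool :=
  if a is Output _ then true else false.

(** Here [st] is an algorithm whose internal randomness has been fixed. Leaving the one-step factor
    [g] arbitrary covers transcript probabilities and their tilted versions alike. *)
Definition path_prod {R : realType} {n : nat} (st : seq 'I_n -> action R n)
    (g : action R n -> 'I_n -> R) (k : nat) (h : k.-tuple 'I_n) : R :=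
  \prod_(t < k) g (st (take t h)) (tnth h t).
Arguments path_prod {R n} st g {k} h.

Lemma path_prod_cons {R : realType} {n : nat} (st : seq 'I_n -> action R n)
    (g : action R n -> 'I_n -> R) (k : nat) (i : 'I_n) (h : k.-tuple 'I_n) :
  path_prod st g [tuple of i :: h] =
  g (st [::]) i * path_prod (fun s => st (i :: s)) g h.
Proof.
rewrite /path_prod big_ord_recl take0 tnth0; congr (_ * _).
by apply: eq_bigr => t _; rewrite tnthS.
Qed.

(** Induction on [N], peeling off the first answer. An output at the root contributes 1 and has no
    descendants, since [g] vanishes there; a query costs a factor of at most [rho]. *)
Lemma stopped_sum_le {R : realType} {n : nat} (g : action R n -> 'I_n -> R)
    (rho : R) (N : nat) (st : seq 'I_n -> action R n) :
  1 <= rho -> (forall a i, 0 <= g a i) -> (forall M i, g (Output M) i = 0) ->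
  (forall S, \sum_i g (Query R S) i <= rho) ->
  \sum_(0 <= k < N.+1)
    \sum_(h : k.-tuple 'I_n | is_output (st h)) path_prod st g h <= rho ^+ N.
Proof.
move=> rho1 g0 gO gQ; elim: N st => [|N IH] st.
  rewrite big_nat1 (big_tuple0 (fun s => is_output (st s))); case: ifP => _; last by rewrite expr0.
  by rewrite /path_prod big_ord0.
rewrite big_nat_recl// (big_tuple0 (fun s => is_output (st s))).
under eq_bigr => k _.
  rewrite (big_tuple_cons k (fun s => is_output (st s))).
  under eq_bigr => i _ do (under eq_bigr => h _ do rewrite path_prod_cons; rewrite -mulr_sumr).
  over.
rewrite exchange_big /=; under eq_bigr => i _ do rewrite -mulr_sumr.
case E: (st [::]) => [S|M] /=.
  rewrite add0r exprS.
  apply: (@le_trans _ _ (\sum_i g (Query R S) i * rho ^+ N)).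
    by apply: ler_sum => i _; rewrite ler_wpM2l// (IH (fun s => st (i :: s))).
  by rewrite -mulr_suml ler_wpM2r// exprn_ge0// (le_trans ler01).
rewrite big1 => [|i _]; last by rewrite gO mul0r.
by rewrite /path_prod big_ord0 addr0 exprn_ege1.
Qed.

(** * Change of measure over a family of hypotheses *)

Lemma choice_prob_ge0 {R : realType} {n : nat} (M : mnl R n) (S : {set 'I_n})
    (i : 'I_n) : 0 <= choice_prob M S i.
Proof.
rewrite /choice_prob; case: ifP => // _; rewrite divr_ge0 ?(ltW (weight_gt0 _ _))//.
by apply: sumr_ge0 => j _; exact/ltW/weight_gt0.
Qed.

Lemma sum_weight_gt0 {R : realType} {n : nat} (M : mnl R n) (S : {set 'I_n}) :
  (0 < #|S|)%N -> 0 < \sum_(j in S) weight M j.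
Proof.
case/card_gt0P => i iS; rewrite (bigD1 i)//= ltr_pwDl ?weight_gt0//.
by apply: sumr_ge0 => j _; exact/ltW/weight_gt0.
Qed.

Lemma sum_choice_prob {R : realType} {n : nat} (M : mnl R n) (S : {set 'I_n}) :
  (0 < #|S|)%N -> \sum_i choice_prob M S i = 1.
Proof.
move=> S0; rewrite -big_mkcond -mulr_suml divff//.
by rewrite gt_eqF// sum_weight_gt0.
Qed.

Lemma answer_prob_ge0 {R : realType} {n : nat} (M : mnl R n) (a : action R n)
    (i : 'I_n) : 0 <= answer_prob M a i.
Proof. by case: a => [S|M'] //=; exact: choice_prob_ge0. Qed.

Definition upd {B m : nat} (theta : {ffun 'I_B -> 'I_m}) (b : 'I_B) (j : 'I_m) :
  {ffun 'I_B -> 'I_m} := [ffun b' => if b' == b then j else theta b'].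

Definition avoids {B m : nat} (J : 'I_B -> 'I_m) (theta : {ffun 'I_B -> 'I_m}) :
  bool := [forall b, theta b != J b].

(** A moved hypothesis [t] agrees with [J] in exactly one block, so [b] can be read off from [t].
    The original [theta] is then determined by its old value at [b], which leaves at most [m]
    preimages. *)
Lemma sum_upd_le {R : realType} {B m : nat} (J : 'I_B -> 'I_m)
    (F : {ffun 'I_B -> 'I_m} -> R) :
  (forall theta, 0 <= F theta) ->
  \sum_(theta | avoids J theta) \sum_b F (upd theta b (J b)) <=
  m%:R * \sum_(theta | ~~ avoids J theta) F theta.
Proof.
move=> F0; rewrite exchange_big /=.
pose hit b (t : {ffun 'I_B -> 'I_m}) :=
  (t b == J b) && [forall b', (b' != b) ==> (t b' != J b')].
apply: (@le_trans _ _ (\sum_b \sum_(t | hit b t) m%:R * F t)).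
  apply: ler_sum => b _.
  rewrite (partition_big (fun t => upd t b (J b)) (hit b)) /=; last first.
    move=> t /forallP tJ; rewrite /hit ffunE eqxx eqxx /=.
    by apply/forallP => b'; apply/implyP => /negPf b'b; rewrite ffunE b'b.
  apply: ler_sum => t _.
  under eq_bigr => u /andP[_ /eqP->] do over.
  rewrite sumr_const -[in leLHS]mulr_natl ler_wpM2r// ler_nat.
  rewrite -[leqRHS]card_ord -(card_in_imset (f := fun u : {ffun 'I_B -> 'I_m} => u b)) ?max_card//.
  move=> u v /andP[_ /eqP ut] /andP[_ /eqP vt] uvb.
  apply/ffunP => b'; have [->//|b'b] := eqVneq b' b.
  by have := congr1 (fun f : {ffun _ -> _} => f b') (etrans ut (esym vt)); rewrite !ffunE (negPf b'b).
rewrite (exchange_big_dep (fun t => ~~ avoids J t)) /=; last first.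
  move=> b t _ /andP[tb _]; apply/forallPn; exists b; by rewrite negbK.
rewrite mulr_sumr; apply: ler_sum => t /forallPn[b0]; rewrite negbK => tb0.
rewrite sumr_const -[leRHS]mulr1n ler_wpMn2l ?mulr_ge0//.
apply: (@leq_trans #|pred1 b0|); last by rewrite card1.
apply/subset_leq_card/fintype.subsetP => b.
rewrite !inE => /andP[_ /forallP/(_ b0)]; rewrite tb0 implybF negbK.
by rewrite eq_sym.
Qed.

(** The only consequence of accuracy that the change of measure keeps: [J M] will pick, in each
    block, an item that the output [M] makes unlikely. *)
Definition consistent {R : realType} {n B m : nat} (J : mnl R n -> 'I_B -> 'I_m)
    (theta : {ffun 'I_B -> 'I_m}) (a : action R n) : bool :=
  if a is Output M then avoids (J M) theta else false.

Section Tradeoff.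
Context {R : realType} {n B m : nat} (M : {ffun 'I_B -> 'I_m} -> mnl R n)
  (J : mnl R n -> 'I_B -> 'I_m)
  (x : {ffun 'I_B -> 'I_m} -> 'I_B -> {set 'I_n} -> 'I_n -> R) (K : R).
Hypotheses (B_gt0 : (0 < B)%N) (K_ge0 : 0 <= K)
  (x_gt0 : forall theta b (S : {set 'I_n}) i, (0 < #|S|)%N -> 0 < x theta b S i)
  (x_dom : forall (theta : {ffun 'I_B -> 'I_m}) b j (S : {set 'I_n}) i, j != theta b -> (0 < #|S|)%N ->
    choice_prob (M theta) S i <= x theta b S i * choice_prob (M (upd theta b j)) S i)
  (x_mean : forall theta (S : {set 'I_n}), (0 < #|S|)%N ->
    \sum_i choice_prob (M theta) S i * \sum_b x theta b S i <= B%:R + K).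

(** The one-step likelihood times the mean of the ratio bounds over the blocks; by [x_mean] it sums
    to at most [1 + K / B] on every slate. The bound [x] does not depend on the target [j] of the
    move, because that target is dictated by the output, which is unknown while the transcript
    unfolds. *)
Let tilted (theta : {ffun 'I_B -> 'I_m}) (a : action R n) (i : 'I_n) : R :=
  if a is Query Q then
    choice_prob (M theta) (val Q) i * ((\sum_b x theta b (val Q) i) / B%:R)
  else 0.

Let tilted_ge0 theta a i : 0 <= tilted theta a i.
Proof.
case: a => //= S; rewrite mulr_ge0 ?choice_prob_ge0// divr_ge0 ?ler0n//.
by apply: sumr_ge0 => b _; exact/ltW/x_gt0/(valP S).
Qed.

(* A change of measure: the second summand is [p Y / c], where [Y] bounds the
   harmonic mean of the likelihood ratios against the [B] moved hypotheses, so
   that their average likelihood is at least [p / Y]; then AM-GM. *)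
Lemma path_prod_moved theta (J0 : 'I_B -> 'I_m) (c : R)
    (st : seq 'I_n -> action R n) (k : nat) (h : k.-tuple 'I_n) :
  0 < c -> avoids J0 theta ->
  2 * path_prod st (answer_prob (M theta)) h <=
  c / B%:R * (\sum_b path_prod st (answer_prob (M (upd theta b (J0 b)))) h)
  + c^-1 * path_prod st (tilted theta) h.
Proof.
move=> c0 /forallP avJ.
(* The value 1 at an output only keeps [X] positive: the path products vanish there anyway. *)
pose X (b : 'I_B) (t : 'I_k) : R :=
  if st (take t h) is Query Q then x theta b (val Q) (tnth h t) else 1.
have X0 b t : 0 < X b t.
  by rewrite /X; case: (st _) => [S|?] //; exact/x_gt0/(valP S).
set p := path_prod st (answer_prob (M theta)) h.
have p0 : 0 <= p by apply: prodr_ge0 => t _; exact: answer_prob_ge0.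
have BR : (0 : R) < B%:R by rewrite ltr0n.
set Y : R := \prod_t ((\sum_b X b t) / B%:R).
have Y0 : 0 < Y.
  apply: prodr_gt0 => t _; rewrite divr_gt0//.
  by rewrite (bigD1 (Ordinal B_gt0))//= ltr_pwDl// sumr_ge0// => b _; exact: ltW.
have -> : path_prod st (tilted theta) h = p * Y.
  rewrite /p /path_prod -big_split /=; apply: eq_bigr => t _.
  by rewrite /X /tilted; case: (st _) => //= *; rewrite mul0r.
have pX b : p * (\prod_t X b t)^-1 <= path_prod st (answer_prob (M (upd theta b (J0 b)))) h.
  rewrite ler_pdivrMr ?prodr_gt0// mulrC /p /path_prod -big_split /=.
  apply: ler_prod => t _; rewrite answer_prob_ge0 /= /X.
  by case: (st _) => [S|?] /=; [apply: x_dom; [rewrite eq_sym | exact: (valP S)] | rewrite mulr0].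
have HM : p / Y <= (\sum_b path_prod st (answer_prob (M (upd theta b (J0 b)))) h) / B%:R.
  apply: le_trans (ler_wpM2l p0 (harmonic_le_prod_mean B_gt0 X0)) _.
  by rewrite mulrA ler_wpM2r ?invr_ge0 ?(ltW BR)// mulr_sumr; apply: ler_sum => b _.
rewrite -mulrA [B%:R^-1 * _]mulrC.
apply: (@le_trans _ _ (c * (p / Y) + c^-1 * (p * Y))); last first.
  by rewrite lerD2r ler_wpM2l// ltW.
rewrite -subr_ge0.
have -> : c * (p / Y) + c^-1 * (p * Y) - 2 * p = p * (c - Y) ^+ 2 / (c * Y).
  by field; rewrite !gt_eqF.
by apply: divr_ge0; apply: mulr_ge0; rewrite ?sqr_ge0 ?(ltW c0) ?(ltW Y0).
Qed.

(** Sums [path_prod_moved] over all hypotheses and all their consistent transcripts, for fixed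
    internal randomness. The parameter [c] is left free and is chosen after integration. *)
Lemma consistent_mass_le (c : R) (N : nat) (st : seq 'I_n -> action R n) :
  0 < c ->
  (2 + c * (m%:R / B%:R)) *
    (\sum_theta \sum_(0 <= k < N.+1)
      \sum_(h : k.-tuple 'I_n | consistent J theta (st h))
        path_prod st (answer_prob (M theta)) h) <=
  #|{ffun 'I_B -> 'I_m}|%:R * (c * (m%:R / B%:R) + c^-1 * (1 + K / B%:R) ^+ N).
Proof.
move=> c0.
have BR : (0 : R) < B%:R by rewrite ltr0n.
set p := fun theta (k : nat) (h : k.-tuple 'I_n) => path_prod st (answer_prob (M theta)) h.
have p0 theta k (h : k.-tuple 'I_n) : 0 <= p theta k h.
  by apply: prodr_ge0 => t _; exact: answer_prob_ge0.
(* The masses of consistent and of inconsistent outputs under [theta], within [N] queries. *)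
pose s theta := \sum_(0 <= k < N.+1) \sum_(h : k.-tuple 'I_n | consistent J theta (st h)) p theta k h.
pose e theta := \sum_(0 <= k < N.+1)
  \sum_(h : k.-tuple 'I_n | is_output (st h) && ~~ consistent J theta (st h)) p theta k h.
have se theta : s theta + e theta <= 1.
  rewrite -[leRHS](expr1n _ N) -big_split /=.
  apply: le_trans (stopped_sum_le (answer_prob (M theta)) 1 N st (lexx _) _ _ _) => //.
  - apply: ler_sum => k _; rewrite [leRHS](bigID (fun h : k.-tuple _ => consistent J theta (st h))) /=.
    rewrite lerD2r le_eqVlt; apply/orP; left; apply/eqP; apply: eq_bigl => h.
    by rewrite /consistent; case: (st h).
  - by move=> a i; exact: answer_prob_ge0.
  - by move=> S; rewrite sum_choice_prob// (valP S).
(* For a fixed transcript, every move turns a consistent hypothesis into an inconsistent one, and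
   [sum_upd_le] counts the overlaps. *)
have moved : \sum_theta \sum_(0 <= k < N.+1) \sum_(h : k.-tuple 'I_n | consistent J theta (st h))
    (\sum_b if st h is Output M' then p (upd theta b (J M' b)) k h else 0)
    <= m%:R * \sum_theta e theta.
  rewrite exchange_big /= [\sum_theta e _]exchange_big /= mulr_sumr; apply: ler_sum => k _.
  rewrite (exchange_big_dep predT)//= [X in _ * X](exchange_big_dep predT)//= mulr_sumr.
  apply: ler_sum => h _; rewrite /consistent; case: (st h) => [S|M'] /=.
    by rewrite !big_pred0_eq mulr0.
  exact: (@sum_upd_le _ _ _ (J M') (fun t => p t k h)).
have tilt theta : \sum_(0 <= k < N.+1) \sum_(h : k.-tuple 'I_n | consistent J theta (st h))
    path_prod st (tilted theta) h <= (1 + K / B%:R) ^+ N.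
  apply: le_trans (stopped_sum_le (tilted theta) _ N st _ _ _ _) => //.
  - apply: ler_sum => k _; rewrite [leLHS]big_mkcond [leRHS]big_mkcond /=; apply: ler_sum => h _.
    rewrite /consistent; case: (st h) => //= M'; case: ifP => // _.
    by apply: prodr_ge0 => t _; exact: tilted_ge0.
  - by rewrite lerDl divr_ge0// ltW.
  - move=> S /=; under eq_bigr => i _ do rewrite mulrA.
    rewrite -mulr_suml ler_pdivrMr// mulrDl mul1r divfK ?gt_eqF//.
    exact: x_mean (valP S).
have key : 2 * (\sum_theta s theta) <=
    c / B%:R * (m%:R * \sum_theta e theta) + c^-1 * (#|{ffun 'I_B -> 'I_m}|%:R * (1 + K / B%:R) ^+ N).
  apply: le_trans (lerD (ler_wpM2l _ moved) (ler_wpM2l _ (_ : \sum_theta \sum_(0 <= k < N.+1) \sum_(h : k.-tuple 'I_n | consistent J theta (st h))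
    path_prod st (tilted theta) h <= _))); rewrite ?divr_ge0 ?invr_ge0 ?(ltW c0) ?(ltW BR)//.
    rewrite !mulr_sumr -big_split /=; apply: ler_sum => theta _.
    rewrite !mulr_sumr -big_split /=; apply: ler_sum => k _.
    rewrite !mulr_sumr -big_split /=; apply: ler_sum => h.
    rewrite /consistent; case: (st h) => // M' avM'.
    exact: path_prod_moved.
  rewrite mulr_natl -sumr_const; apply: ler_sum => theta _; exact: tilt.
have eb : \sum_theta e theta <= #|{ffun 'I_B -> 'I_m}|%:R - \sum_theta s theta.
  rewrite -[#|_|%:R]mulr1 mulr_natl -sumr_const -sumrB; apply: ler_sum => theta _.
  by rewrite lerBrDr addrC.
have cm : 0 <= c * (m%:R / B%:R) by rewrite mulr_ge0 ?divr_ge0 ?ler0n ?ltW.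
have := ler_wpM2l cm eb.
rewrite -/(\sum_theta s theta); move: key.
set S1 := \sum_theta s theta; set E1 := \sum_theta e theta.
have -> : c / B%:R * (m%:R * E1) = c * (m%:R / B%:R) * E1 by rewrite !mulrA; congr (_ * _); ring.
lra.
Qed.

End Tradeoff.

(** * Planted models *)

Section Planted.
Context {R : realType} {n B m : nat} (item : 'I_B * 'I_m -> 'I_n) (kappa : R).
Hypotheses (item_inj : injective item) (kappa_gt0 : 0 < kappa).

Definition planted_weight (theta : {ffun 'I_B -> 'I_m}) (i : 'I_n) : R :=
  1 + kappa * \sum_b (i == item (b, theta b))%:R.

Lemma planted_weight_ge1 theta i : 1 <= planted_weight theta i.
Proof. by rewrite lerDl mulr_ge0 ?(ltW kappa_gt0)// sumr_ge0. Qed.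

Lemma planted_weight_gt0 theta i : 0 < planted_weight theta i.
Proof. exact: lt_le_trans ltr01 (planted_weight_ge1 _ _). Qed.

Definition planted (theta : {ffun 'I_B -> 'I_m}) : mnl R n :=
  MNL (planted_weight_gt0 theta).

Lemma planted_weight_item theta b j :
  planted_weight theta (item (b, j)) = 1 + kappa * (j == theta b)%:R.
Proof.
rewrite /planted_weight (bigD1 b)//= big1 ?addr0 => [|b' b'b].
  by rewrite (inj_eq item_inj) xpair_eqE eqxx.
by rewrite (inj_eq item_inj) xpair_eqE eq_sym (negPf b'b).
Qed.

Lemma planted_weight_upd (theta : {ffun 'I_B -> 'I_m}) b j i :
  planted_weight (upd theta b j) i = planted_weight theta i
    - kappa * (i == item (b, theta b))%:R + kappa * (i == item (b, j))%:R.
Proof.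
rewrite /planted_weight (bigD1 b)//= [in RHS](bigD1 b)//= ffunE eqxx.
under eq_bigr => b' /negPf b'b do rewrite ffunE b'b.
ring.
Qed.

Let total theta (S : {set 'I_n}) : R := \sum_(i in S) planted_weight theta i.

Lemma sum_eq_in (S : {set 'I_n}) (u : 'I_n) :
  \sum_(i in S) ((i == u)%:R : R) = (u \in S)%:R.
Proof.
have [uS|uS] := boolP (u \in S).
  rewrite (bigD1 u)//= eqxx big1 ?addr0// => i /andP[_ /negPf->] //.
by rewrite big1// => i iS; case: eqP => // iu; rewrite -iu iS in uS.
Qed.

Lemma total_upd (theta : {ffun 'I_B -> 'I_m}) b j S : total (upd theta b j) S = total theta S
  - kappa * (item (b, theta b) \in S)%:R + kappa * (item (b, j) \in S)%:R.
Proof.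
rewrite /total; under eq_bigr => i _ do rewrite planted_weight_upd.
by rewrite big_split sumrB /= -!mulr_sumr !sum_eq_in.
Qed.

Lemma card_le_total theta (S : {set 'I_n}) : #|S|%:R <= total theta S.
Proof.
rewrite -sumr_const; apply: ler_sum => i _; exact: planted_weight_ge1.
Qed.

Lemma sum_items_in_le (S : {set 'I_n}) :
  \sum_b \sum_j ((item (b, j) \in S)%:R : R) <= #|S|%:R.
Proof.
rewrite pair_big /= (eq_bigr (fun u => (item u \in S)%:R)) => [|[]//].
rewrite -natr_sum ler_nat /nat_of_bool -big_mkcond /= sum1_card.
rewrite -(card_imset _ item_inj); apply/subset_leq_card/fintype.subsetP.
by move=> _ /imsetP[u uS ->].
Qed.

Lemma choice_prob_planted theta (S : {set 'I_n}) i :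
  choice_prob (planted theta) S i = (i \in S)%:R * (planted_weight theta i / total theta S).
Proof. by rewrite /choice_prob; case: ifP; rewrite ?mul1r ?mul0r. Qed.

Lemma total_gt0 theta (S : {set 'I_n}) : (0 < #|S|)%N -> 0 < total theta S.
Proof. by move=> S0; apply: lt_le_trans (card_le_total _ _); rewrite ltr0n. Qed.

(** Pigeonhole: the [m] probabilities on the slate of the block sum to 1. *)
Lemma block_unlikely_item (M' : mnl R n) (b : 'I_B) : (0 < m)%N -> exists j,
  choice_prob M' [set item (b, j') | j' : 'I_m] (item (b, j)) <= m%:R^-1.
Proof.
move=> m0; apply/not_existsP => H.
have inj : injective (fun j => item (b, j)) by move=> j j' /item_inj[].
have S0 : (0 < #|[set item (b, j') | j' : 'I_m]|)%N by rewrite card_imset// card_ord.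
have := sum_choice_prob M' _ S0; rewrite -big_mkcond /= big_imset /=; last by move=> ? ? _ _ /inj.
apply/eqP; rewrite gt_eqF//.
apply: (@le_lt_trans _ _ (\sum_(j < m) m%:R^-1)).
  by rewrite sumr_const card_ord -(mulr_natl _^-1) divff// pnatr_eq0 -lt0n.
apply: ltr_sum => [|j _].
  by apply/hasP; exists (Ordinal m0) => //; rewrite mem_index_enum.
have /negP := H j; rewrite -ltNge /choice_prob imset_f//.
Qed.

Lemma planted_block_prob theta (b : 'I_B) :
  choice_prob (planted theta) [set item (b, j) | j : 'I_m] (item (b, theta b)) =
  (1 + kappa) / (m%:R + kappa).
Proof.
rewrite /choice_prob imset_f//= planted_weight_item eqxx mulr1; congr (_ / _).
rewrite big_imset /=; last by move=> j j' _ _ /item_inj[].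
under eq_bigr => j _ do rewrite planted_weight_item.
rewrite big_split /= sumr_const card_ord -mulr_sumr; congr (_ + _).
by rewrite (bigD1 (theta b))//= eqxx big1 ?addr0 ?mulr1// => j /negPf->.
Qed.

(** If [theta b] were [J M' b], the special item of block [b] would have probability
    [(1 + kappa) / (m + kappa)] in the planted model but at most [1 / m] in the output, a gap larger
    than [eps]. *)
Lemma accurate_consistent (eps : R) (J : mnl R n -> 'I_B -> 'I_m) theta (a : action R n) :
  (forall M' b, choice_prob M' [set item (b, j) | j : 'I_m] (item (b, J M' b)) <= m%:R^-1) ->
  eps < (1 + kappa) / (m%:R + kappa) - m%:R^-1 ->
  accurate (planted theta) eps a -> consistent J theta a.
Proof.
move=> HJ gap; case: a => //= M' acc; apply/forallP => b; apply/eqP => bJ.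
have S0 : (0 < #|[set item (b, j) | j : 'I_m]|)%N.
  by apply/card_gt0P; exists (item (b, theta b)); rewrite imset_f.
have := HJ M' b; rewrite -bJ; apply/negP; rewrite -ltNge.
have : `|choice_prob (planted theta) [set item (b, j) | j : 'I_m] (item (b, theta b))
  - choice_prob M' [set item (b, j) | j : 'I_m] (item (b, theta b))| <= eps.
  apply: le_trans acc.
  pose S : slate n := exist (fun S : {set 'I_n} => is_true (0 < #|S|)%N) _ S0.
  apply: (bigmax_sup S) => //=.
  by apply: (bigmax_sup (item (b, theta b))) => //=; rewrite imset_f.
rewrite planted_block_prob; move: (choice_prob _ _ _) => y.
rewrite ler_norml => /andP[_]; lra.
Qed.

(** Written with weights and totals rather than as a quotient of choice probabilities, so that it
    stays positive for items outside [S]. *)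
Definition likelihood_ratio (theta : {ffun 'I_B -> 'I_m}) b j (S : {set 'I_n}) i : R :=
  planted_weight theta i / planted_weight (upd theta b j) i *
  (total (upd theta b j) S / total theta S).

Lemma likelihood_ratio_gt0 (theta : {ffun 'I_B -> 'I_m}) b j (S : {set 'I_n}) i :
  (0 < #|S|)%N -> 0 < likelihood_ratio theta b j S i.
Proof.
by move=> S0; rewrite mulr_gt0// divr_gt0// ?planted_weight_gt0 ?total_gt0.
Qed.

Lemma likelihood_ratioE (theta : {ffun 'I_B -> 'I_m}) b j (S : {set 'I_n}) i : (0 < #|S|)%N ->
  choice_prob (planted theta) S i =
  likelihood_ratio theta b j S i * choice_prob (planted (upd theta b j)) S i.
Proof.
move=> S0; rewrite !choice_prob_planted /likelihood_ratio.
have := total_gt0 theta _ S0; have := total_gt0 (upd theta b j) _ S0.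
have := planted_weight_gt0 theta i; have := planted_weight_gt0 (upd theta b j) i.
by move=> *; field; rewrite !gt_eqF.
Qed.

(* The left-hand side is one plus a chi-square divergence; being first order
   in [kappa], the likelihood ratio has no first-order term on average. *)
Lemma sum_likelihood_ratio_le (theta : {ffun 'I_B -> 'I_m}) b j (S : {set 'I_n}) : j != theta b -> (0 < #|S|)%N ->
  \sum_i choice_prob (planted theta) S i * likelihood_ratio theta b j S i <=
  1 + kappa ^+ 2 * ((item (b, theta b) \in S)%:R + (item (b, j) \in S)%:R) / total theta S.
Proof.
move=> jb S0; set Z := total theta S; set a := (_ \in S)%:R; set c := (_ \in S)%:R.
have Z0 : 0 < Z by exact: total_gt0.
have Z1 : 1 <= Z by apply: le_trans (card_le_total _ _); rewrite ler1n.
have W0 : 0 < 1 + kappa by rewrite addr_gt0.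
have uv : (item (b, theta b) == item (b, j)) = false.
  by rewrite (inj_eq item_inj) xpair_eqE eqxx /= eq_sym (negPf jb).
(* The squared old weight over the new weight equals the old weight except at the two items of the
   move: it is [(1 + kappa) ^ 2] at the old special item and [1 / (1 + kappa)] at the new one. *)
have E i : choice_prob (planted theta) S i * likelihood_ratio theta b j S i =
    (i \in S)%:R * (planted_weight theta i
      + (1 + kappa) * kappa * (i == item (b, theta b))%:R
      - kappa / (1 + kappa) * (i == item (b, j))%:R) * ((Z - kappa * a + kappa * c) / Z ^+ 2).
  rewrite choice_prob_planted /likelihood_ratio planted_weight_upd total_upd -/Z -/a -/c.
  have [->|iu] := eqVneq i (item (b, theta b)).
    rewrite uv planted_weight_item !eqxx /=.
    by field; rewrite !gt_eqF//; lra.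
  have [iv|iv] := eqVneq i (item (b, j)).
    rewrite iv planted_weight_item (negPf jb) /=.
    by field; rewrite !gt_eqF//; lra.
  rewrite -[false%:R]/(0 : R); have := planted_weight_gt0 theta i; move: (planted_weight theta i) => w w0.
  by field; rewrite !gt_eqF//; lra.
under eq_bigr => i _ do rewrite E.
rewrite -mulr_suml.
have -> : \sum_i (i \in S)%:R * (planted_weight theta i
      + (1 + kappa) * kappa * (i == item (b, theta b))%:R
      - kappa / (1 + kappa) * (i == item (b, j))%:R) =
   Z + (1 + kappa) * kappa * a - kappa / (1 + kappa) * c.
  under eq_bigr => i _ do rewrite mulr_natl mulrb.
  by rewrite -big_mkcond sumrB big_split /= -!mulr_sumr !sum_eq_in.
have a01 : a = 0 \/ a = 1 by rewrite /a; case: (_ \in S); [right|left].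
have c01 : c = 0 \/ c = 1 by rewrite /c; case: (_ \in S); [right|left].
rewrite mulrA ler_pdivrMr ?exprn_gt0//.
rewrite (_ : (_ + _ / Z) * Z ^+ 2 = Z ^+ 2 + kappa ^+ 2 * (a + c) * Z); last first.
  by field; rewrite gt_eqF.
(* The identity [kappa - y = kappa * y] makes the difference a visibly nonnegative expression in
   each of the four cases for [a] and [c]. *)
set y := kappa / (1 + kappa).
have yE : y * (1 + kappa) = kappa by rewrite divfK// gt_eqF.
have ye : kappa - y = kappa * y by rewrite -[in LHS]yE; ring.
have y0 : 0 < y by rewrite divr_gt0.
have k0 := kappa_gt0.
rewrite -subr_ge0; clearbody y Z.
case: a01 => ->; case: c01 => ->.
- by rewrite !(mulr0, addr0, subr0, mul0r) expr2 subrr.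
- rewrite (_ : _ - _ = kappa ^+ 2 * Z - Z * (kappa - y) + kappa * y); last by ring.
  rewrite ye (_ : _ + _ = kappa * y + Z * kappa * (kappa - y)); last by ring.
  rewrite ye; by repeat (apply: addr_ge0 || apply: mulr_ge0); exact: ltW.
- rewrite (_ : _ - _ = (1 + kappa) * kappa ^+ 2); last by ring.
  by rewrite mulr_ge0 ?sqr_ge0 ?(ltW W0).
- rewrite (_ : _ - _ = Z * (kappa ^+ 2 - (kappa - y))); last by ring.
  rewrite ye (_ : _ - _ = kappa * (kappa - y)); last by ring.
  rewrite ye; by repeat (apply: addr_ge0 || apply: mulr_ge0); exact: ltW.
Qed.

End Planted.

(** * Likelihood ratios of planted models *)

Section PlantedRatios.
Context {R : realType} {n B m : nat} (item : 'I_B * 'I_m -> 'I_n) (kappa : R).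
Hypotheses (item_inj : injective item) (kappa_gt0 : 0 < kappa).
Local Notation planted := (planted item kappa kappa_gt0).
Local Notation weight_of := (planted_weight item kappa).
Let total theta (S : {set 'I_n}) : R := \sum_(i in S) weight_of theta i.

(* Bounds the likelihood ratios of all moves of the special item of block [b],
   at the price of being [1 + O(kappa)] instead of [1 + O(kappa^2)] on average. *)
Definition crude_ratio (theta : {ffun 'I_B -> 'I_m}) b (S : {set 'I_n}) i : R :=
  (1 + kappa * (i == item (b, theta b))%:R) *
  (1 + kappa * (\sum_j (item (b, j) \in S)%:R) / total theta S).

Lemma crude_ratio_gt0 theta b (S : {set 'I_n}) i :
  (0 < #|S|)%N -> 0 < crude_ratio theta b S i.
Proof.
move=> S0; have Z0 : 0 < total theta S by exact: total_gt0.
rewrite mulr_gt0// ltr_pwDl// ?divr_ge0 ?(ltW Z0)// mulr_ge0 ?(ltW kappa_gt0)//.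
by rewrite sumr_ge0.
Qed.

(** The first factor bounds the ratio of weights, which exceeds 1 only at the old special item. The
    second bounds the growth of the total, which is at most [kappa] and needs [item (b, j)] in
    [S]. *)
Lemma crude_ratio_dom (theta : {ffun 'I_B -> 'I_m}) b j (S : {set 'I_n}) i :
  j != theta b -> (0 < #|S|)%N ->
  choice_prob (planted theta) S i <=
  crude_ratio theta b S i * choice_prob (planted (upd theta b j)) S i.
Proof.
move=> jb S0; rewrite (likelihood_ratioE item _ kappa_gt0 theta b j)//.
rewrite ler_wpM2r ?choice_prob_ge0//.
have Z0 : 0 < total theta S by exact: total_gt0.
have w0 := planted_weight_gt0 item _ kappa_gt0 (upd theta b j) i.
have Z'0 : 0 < total (upd theta b j) S by exact: total_gt0.
apply: ler_pM; rewrite ?divr_ge0 ?(ltW w0) ?(ltW Z0) ?(ltW Z'0)//.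
- exact/ltW/planted_weight_gt0.
- rewrite ler_pdivrMr// planted_weight_upd.
  have k0 := kappa_gt0; have [->|iu] := eqVneq i (item (b, theta b)).
    rewrite planted_weight_item// !eqxx (inj_eq item_inj) xpair_eqE eqxx /=.
    by rewrite eq_sym (negPf jb) /=; lra.
  rewrite /= mulr0 subr0 addr0 mul1r lerDl mulr_ge0//; exact: ltW.
- rewrite ler_pdivrMr// mulrDl mul1r divfK ?gt_eqF// /total total_upd.
  rewrite lerD//; first by rewrite gerBl mulr_ge0 ?(ltW kappa_gt0).
  by rewrite ler_wpM2l ?(ltW kappa_gt0)// (bigD1 j)//= lerDl sumr_ge0.
Qed.

(** An item is special for at most one block, and the blocks share at most [#|S|] items of the
    slate. These two facts contribute [kappa] and [kappa * (1 + kappa)]. *)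
Lemma crude_ratio_mean theta (S : {set 'I_n}) : (0 < #|S|)%N ->
  \sum_i choice_prob (planted theta) S i * \sum_b crude_ratio theta b S i <=
  B%:R + kappa * (2 + kappa).
Proof.
move=> S0; have Z0 : 0 < total theta S by exact: total_gt0.
set p := choice_prob (planted theta) S.
have p0 i : 0 <= p i by exact: choice_prob_ge0.
have p1 : \sum_i p i = 1 by exact: sum_choice_prob.
have k0 := ltW kappa_gt0.
pose C b : R := \sum_j (item (b, j) \in S)%:R.
have C0 b : 0 <= C b by apply: sumr_ge0.
have CZ : (\sum_b C b) / total theta S <= 1.
  rewrite ler_pdivrMr// mul1r; apply: le_trans (card_le_total item _ kappa_gt0 _ _).
  exact: sum_items_in_le.
have hit : \sum_i p i * \sum_b ((i == item (b, theta b))%:R : R) <= 1.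
  rewrite -[leRHS]p1; apply: ler_sum => i _; rewrite -[leRHS]mulr1 ler_wpM2l//.
  have [/existsP[b /eqP ->]|/existsPn ne] := boolP [exists b, i == item (b, theta b)].
    rewrite (bigD1 b)//= eqxx big1 ?addr0// => b' b'b.
    by rewrite (inj_eq item_inj) xpair_eqE eq_sym (negPf b'b).
  by rewrite big1// => b _; rewrite (negPf (ne b)).
have x_le b i : crude_ratio theta b S i <=
    1 + kappa * (i == item (b, theta b))%:R + kappa * (1 + kappa) * (C b / total theta S).
  have : 0 <= C b / total theta S by rewrite divr_ge0// ltW.
  rewrite /crude_ratio -/(C b) -mulrA; move: (C b / _) => y y0.
  have ky : 0 <= kappa * kappa * y by rewrite !mulr_ge0.
  have k0y : 0 <= kappa * y by rewrite !mulr_ge0.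
  by case: eqP => _ /=; nra.
apply: (@le_trans _ _ (\sum_i p i * (B%:R + kappa * \sum_b (i == item (b, theta b))%:R
   + kappa * (1 + kappa) * ((\sum_b C b) / total theta S)))).
  apply: ler_sum => i _; rewrite ler_wpM2l//.
  have -> : (B%:R : R) = \sum_(b < B) 1 by rewrite sumr_const card_ord.
  rewrite mulr_suml !mulr_sumr -!big_split /=; apply: ler_sum => b _; exact: x_le.
under eq_bigr => i _ do rewrite !mulrDr.
rewrite !big_split /= -!mulr_suml p1 !mul1r -addrA lerD2l.
under eq_bigr => i _ do rewrite mulrCA.
rewrite -mulr_sumr.
have := ler_wpM2l k0 hit.
have : kappa * (1 + kappa) * ((\sum_b C b) / total theta S) <= kappa * (1 + kappa) * 1.
  by rewrite ler_wpM2l// mulr_ge0// addr_ge0.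
lra.
Qed.

End PlantedRatios.

(** With two items per block there is only one possible move, so the exact likelihood ratio can
    serve as [x]. The chi-square terms of the disjoint pairs add up to at most
    [kappa ^ 2 * #|S| / total]. *)
Lemma flip_ratio_mean {R : realType} {n B : nat} (item : 'I_B * 'I_2 -> 'I_n)
    (kappa : R) (item_inj : injective item) (kappa_gt0 : 0 < kappa)
    (theta : {ffun 'I_B -> 'I_2}) (S : {set 'I_n}) : (0 < #|S|)%N ->
  \sum_i choice_prob (planted item kappa kappa_gt0 theta) S i *
    \sum_b likelihood_ratio item kappa theta b (rev_ord (theta b)) S i <=
  B%:R + kappa ^+ 2.
Proof.
move=> S0; have Z0 := total_gt0 item _ kappa_gt0 theta _ S0.
have rev_neq (j : 'I_2) : rev_ord j != j by case: j => [[|[]]].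
under eq_bigr => i _ do rewrite mulr_sumr.
rewrite exchange_big /=.
apply: le_trans (ler_sum _ (fun b _ =>
  sum_likelihood_ratio_le _ _ item_inj kappa_gt0 theta b (rev_ord (theta b)) _ (rev_neq _) S0)) _.
rewrite big_split /= sumr_const card_ord lerD2l.
rewrite -mulr_suml -mulr_sumr -mulrA ler_piMr ?sqr_ge0// ler_pdivrMr// mul1r.
apply: le_trans (card_le_total item _ kappa_gt0 _ _).
apply: le_trans (sum_items_in_le _ item_inj S).
apply: ler_sum => b _; rewrite (bigD1 (theta b))//= lerD2l.
by rewrite (bigD1 (rev_ord (theta b)))//= lerDl sumr_ge0.
Qed.

(** * Measurability of the success probability *)

Section Measurability.
Context {R : realType} {n : nat} {d : measure_display}
  {Omega : measurableType d} (A : algorithm R n Omega) (M : mnl R n).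

Lemma measurable_forall {I : finType} (p : I -> Omega -> bool) :
  (forall i, measurable_fun setT (p i)) ->
  measurable_fun setT (fun w => [forall i, p i w]).
Proof.
move=> mp; apply: (measurable_fun_bool true).
rewrite (_ : _ `&` _ = \bigcap_(i in [set: I]) (p i @^-1` [set true])).
  apply: fin_bigcap_measurable => [|i _]; first exact: finite_finset.
  by rewrite -[_ @^-1` _]setTI; apply: mp.
rewrite setTI; apply/seteqP; split=> w /=; first by move=> /forallP H i _; exact: H.
by move=> H; apply/forallP => i; exact: H.
Qed.

Lemma measurable_is_query (h : seq 'I_n) (S : slate n) :
  measurable_fun setT (fun w => `[< step A h w = Query R S >]).
Proof.
apply: (measurable_fun_bool true); rewrite setTI.
rewrite (_ : _ @^-1` _ = [set w | step A h w = Query R S]); first exact: measurable_query.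
by apply/seteqP; split=> w /= /asboolP.
Qed.

Lemma measurable_answer_prob (h : seq 'I_n) (i : 'I_n) :
  measurable_fun setT (fun w => answer_prob M (step A h w) i).
Proof.
rewrite (_ : (fun w => _) = fun w => \sum_(S : slate n)
    if `[< step A h w = Query R S >] then choice_prob M (val S) i else 0).
  apply: measurable_sum => S; apply: measurable_fun_ifT => //.
  exact: measurable_is_query.
apply/funext => w; case: (step A h w) => [Q|M'] /=.
  rewrite (bigD1 Q)//= asboolT// big1 ?addr0// => S SQ; rewrite asboolF//.
  by case=> QS; rewrite QS eqxx in SQ.
by rewrite big1// => S _; rewrite asboolF.
Qed.

(** Clearing denominators expresses accuracy by finitely many inequalities in the weights of [M'],
    which are the measurable quantities [out_weight]. *)
Lemma d_infty_le (M' : mnl R n) (eps : R) : 0 <= eps ->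
  (d_infty M M' <= eps) =
  [forall S : slate n, forall i : 'I_n, (i \in val S) ==>
    (`|choice_prob M (val S) i * (\sum_(j in val S) weight M' j) - weight M' i|
      <= eps * \sum_(j in val S) weight M' j)].
Proof.
move=> eps0.
have E (S : slate n) i : i \in val S ->
    (`|choice_prob M (val S) i - choice_prob M' (val S) i| <= eps) =
    (`|choice_prob M (val S) i * (\sum_(j in val S) weight M' j) - weight M' i|
      <= eps * \sum_(j in val S) weight M' j).
  move=> iS; set p := choice_prob M _ i; rewrite /choice_prob iS.
  have Z0 := sum_weight_gt0 M' _ (valP S); set Z := \sum_(j in _) weight M' j in Z0 *.
  have -> : p * Z - weight M' i = (p - weight M' i / Z) * Z by rewrite mulrBl divfK ?gt_eqF.
  by rewrite normrM (gtr0_norm Z0) ler_pM2r.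
apply/idP/forallP => [dM S|H].
  apply/forallP => i; apply/implyP => iS; rewrite -E//; apply: le_trans dM.
  by apply: (bigmax_sup S) => //; exact: (bigmax_sup i).
apply: bigmax_le => // S _; apply: bigmax_le => // i iS; rewrite E//.
by have /forallP/(_ i)/implyP := H S; apply.
Qed.

Lemma measurable_accurate (eps : R) (h : seq 'I_n) : 0 <= eps ->
  measurable_fun setT (fun w => accurate M eps (step A h w)).
Proof.
move=> eps0.
pose o w i := out_weight (step A h w) i.
have mo i : measurable_fun setT (o ^~ i) by exact: measurable_output.
(* The first conjunct excludes queries: their encoded weights are all 0 and satisfy the inequalities
   trivially. *)
rewrite (_ : (fun w => _) = fun w => [forall S : slate n, ~~ `[< step A h w = Query R S >]]
   && [forall S : slate n, forall i : 'I_n, (i \in val S) ==>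
    (`|choice_prob M (val S) i * (\sum_(j in val S) o w j) - o w i|
      <= eps * \sum_(j in val S) o w j)]).
  have mZ (S : slate n) : measurable_fun setT (fun w => \sum_(j in val S) o w j).
    under eq_fun do rewrite big_mkcond /=.
    by apply: measurable_sum => j; case: (j \in val S).
  apply: measurable_and.
    by apply: measurable_forall => S; apply: measurable_neg; exact: measurable_is_query.
  apply: measurable_forall => S; apply: measurable_forall => i.
  case: (i \in val S) => //=.
  apply: measurable_fun_ler; last by apply: measurable_funM => //; exact: mZ.
  apply: measurableT_comp => //; apply: measurable_funB; last exact: mo.
  by apply: measurable_funM => //; exact: mZ.
apply/funext => w; rewrite /o; case: (step A h w) => [Q|M'] /=.
  apply/esym/negbTE; rewrite negb_and; apply/orP; left.
  by apply/forallPn; exists Q; rewrite negbK; apply/asboolP.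
rewrite d_infty_le//; apply/esym/andb_idl => _.
by apply/forallP => S; apply/asboolPn.
Qed.

Lemma measurable_transcript_prob (k : nat) (h : k.-tuple 'I_n) :
  measurable_fun setT (transcript_prob A M h).
Proof. by apply: measurable_prod => t _; exact: measurable_answer_prob. Qed.

Lemma transcript_prob_ge0 (k : nat) (h : k.-tuple 'I_n) (w : Omega) :
  0 <= transcript_prob A M h w.
Proof. by apply: prodr_ge0 => t _; exact: answer_prob_ge0. Qed.

Definition accurate_at (eps : R) (k : nat) (w : Omega) : R :=
  \sum_(h : k.-tuple 'I_n | accurate M eps (step A h w)) transcript_prob A M h w.

Lemma accurate_at_ge0 eps k w : 0 <= accurate_at eps k w.
Proof. by apply: sumr_ge0 => h _; exact: transcript_prob_ge0. Qed.

Lemma measurable_accurate_at eps k : 0 <= eps ->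
  measurable_fun setT (accurate_at eps k).
Proof.
move=> eps0; rewrite (_ : accurate_at eps k = fun w => \sum_(h : k.-tuple 'I_n)
    if accurate M eps (step A h w) then transcript_prob A M h w else 0).
  apply: measurable_sum => h; apply: measurable_fun_ifT => //.
    exact: measurable_accurate.
  exact: measurable_transcript_prob.
by apply/funext => w; rewrite /accurate_at big_mkcond.
Qed.

(** A term with [k > N] is dominated by the probability of making [k] queries, which is 0. The
    finite sum left can be bounded pointwise in [w]. *)
Lemma prob_accurate_truncated (P : probability Omega R) (eps : R) (N : nat) :
  0 <= eps -> (forall k, (N < k)%N -> prob_queries_ge P A M k = 0%E) ->
  prob_accurate P A M eps = (\int[P]_w (\sum_(0 <= k < N.+1) accurate_at eps k w)%:E)%E.
Proof.
move=> eps0 H; rewrite /prob_accurate.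
have me k : measurable_fun setT (fun w => (accurate_at eps k w)%:E).
  by apply/measurable_EFinP; exact: measurable_accurate_at.
have e0 k w : (0 <= (accurate_at eps k w)%:E)%E by rewrite lee_fin accurate_at_ge0.
apply: etrans (integral_nneseries _ measurableT me (fun k w _ => e0 k w)) _.
apply: etrans (nneseries_split 0 N.+1 (fun k _ => integral_ge0 P (fun w _ => e0 k w))) _.
rewrite add0n eseries0 ?adde0 => [|k Nk _]; last first.
  apply/eqP; rewrite eq_le integral_ge0// andbT -(H _ Nk).
  apply: ge0_le_integral => //.
    apply/measurable_EFinP; apply: measurable_sum => h; exact: measurable_transcript_prob.
  move=> w _; rewrite lee_fin /accurate_at big_mkcond; apply: ler_sum => h _.
  by case: ifP => // _; exact: transcript_prob_ge0.
by rewrite -ge0_integral_sum//; apply: eq_integral => w _; rewrite sumEFin.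
Qed.

End Measurability.

(** * Lower bounds on the number of queries *)

Section Hypotheses.
Context {R : realType} {n B m : nat} (M : {ffun 'I_B -> 'I_m} -> mnl R n)
  (J : mnl R n -> 'I_B -> 'I_m)
  (x : {ffun 'I_B -> 'I_m} -> 'I_B -> {set 'I_n} -> 'I_n -> R) (K : R).
Hypotheses (B_gt0 : (0 < B)%N) (m_gt0 : (0 < m)%N) (K_gt0 : 0 < K)
  (x_gt0 : forall theta b (S : {set 'I_n}) i, (0 < #|S|)%N -> 0 < x theta b S i)
  (x_dom : forall (theta : {ffun 'I_B -> 'I_m}) b j (S : {set 'I_n}) i,
    j != theta b -> (0 < #|S|)%N ->
    choice_prob (M theta) S i <= x theta b S i * choice_prob (M (upd theta b j)) S i)
  (x_mean : forall theta (S : {set 'I_n}), (0 < #|S|)%N ->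
    \sum_i choice_prob (M theta) S i * \sum_b x theta b S i <= B%:R + K).
Context {d : measure_display} {Omega : measurableType d}
  (P : probability Omega R) (A : algorithm R n Omega) (eps delta : R).
Hypotheses (eps_ge0 : 0 <= eps) (delta01 : 0 < delta < 1)
  (accJ : forall theta a, accurate (M theta) eps a -> consistent J theta a)
  (accA : forall theta, ((1 - delta)%:E <= prob_accurate P A (M theta) eps)%E).

Lemma success_tradeoff (N : nat) :
  (forall theta k, (N < k)%N -> prob_queries_ge P A (M theta) k = 0%E) ->
  (1 - delta) ^+ 2 * B%:R <= m%:R * delta * (1 + K / B%:R) ^+ N.
Proof.
move=> H; have /andP[d0 d1] := delta01.
have BR : (0 : R) < B%:R by rewrite ltr0n.
have mR : (0 : R) < m%:R by rewrite ltr0n.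
have a0 : 0 < 1 - delta by rewrite subr_gt0.
(* This choice gives [c' * delta = 1 - delta], after which the integrated inequality collapses to
   [(1 - delta) * c <= rho ^ N]. *)
pose c : R := (1 - delta) * B%:R / (m%:R * delta).
have c0 : 0 < c by rewrite divr_gt0// mulr_gt0.
set rho := 1 + K / B%:R.
pose T : R := #|{ffun 'I_B -> 'I_m}|%:R.
have T0 : 0 < T by rewrite ltr0n card_ffun !card_ord expn_gt0 m_gt0.
pose c' : R := c * (m%:R / B%:R).
have c'0 : 0 < c' by rewrite mulr_gt0// divr_gt0.
pose F w := \sum_theta \sum_(0 <= k < N.+1) accurate_at A (M theta) eps k w.
have Fle w : F w <= T * (c' + c^-1 * rho ^+ N) / (2 + c').
  rewrite ler_pdivlMr ?addr_gt0// mulrC.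
  apply: le_trans (consistent_mass_le M J x K B_gt0 (ltW K_gt0) x_gt0 x_dom x_mean c N
    (fun s => step A s w) c0).
  rewrite ler_wpM2l ?(ltW (addr_gt0 _ _))//.
  apply: ler_sum => theta _; apply: ler_sum => k _.
  rewrite /accurate_at [leLHS]big_mkcond [leRHS]big_mkcond /=; apply: ler_sum => h _.
  case: ifP => [/accJ->//|_]; case: ifP => // _; exact: transcript_prob_ge0.
have mk theta k : measurable_fun setT (accurate_at A (M theta) eps k).
  exact: measurable_accurate_at.
have msum theta : measurable_fun setT (fun w => \sum_(0 <= k < N.+1) accurate_at A (M theta) eps k w).
  by apply: measurable_sum => k; exact: mk.
have sum_ge0 theta w : 0 <= \sum_(0 <= k < N.+1) accurate_at A (M theta) eps k w.
  by apply: sumr_ge0 => k _; exact: accurate_at_ge0.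
have : ((T * (1 - delta))%:E <= (T * (c' + c^-1 * rho ^+ N) / (2 + c'))%:E)%E.
  apply: (@le_trans _ _ (\int[P]_w (F w)%:E)%E); last first.
    apply: (@le_trans _ _ (\int[P]_w (cst (T * (c' + c^-1 * rho ^+ N) / (2 + c'))%:E) w)%E).
      apply: ge0_le_integral => //.
      - by move=> w _; rewrite lee_fin; apply: sumr_ge0.
      - by apply/measurable_EFinP; apply: measurable_sum => theta; exact: msum.
      - by move=> w _; rewrite lee_fin; exact: Fle.
    rewrite integral_cst// le_eqVlt; apply/orP; left; apply/eqP.
    by rewrite -[RHS]mule1; congr (_ * _)%E; exact: probability_setT.
  have -> : (\int[P]_w (F w)%:E)%E = (\sum_theta prob_accurate P A (M theta) eps)%E.
    under [RHS]eq_bigr => theta _ do rewrite (prob_accurate_truncated _ _ _ _ _ eps_ge0 (H theta)).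
    rewrite -ge0_integral_sum//.
    - by apply: eq_integral => w _; rewrite sumEFin.
    - by move=> theta; apply/measurable_EFinP; exact: msum.
    - by move=> theta w _; rewrite lee_fin.
  rewrite mulrC mulr_natr -sumr_const -sumEFin.
  by apply: lee_sum => theta _.
rewrite lee_fin -mulrA ler_pM2l// ler_pdivlMr ?addr_gt0// => key.
have c'd : c' * delta = 1 - delta by rewrite /c' /c; field; rewrite !gt_eqF.
have {key} key : (1 - delta) * c <= rho ^+ N.
  rewrite -ler_pdivlMr// [leRHS]mulrC; lra.
have -> : (1 - delta) ^+ 2 * B%:R = (1 - delta) * c * (m%:R * delta).
  by rewrite /c; field; rewrite !gt_eqF.
by rewrite [leRHS]mulrC ler_wpM2r// ltW// mulr_gt0.
Qed.

(** Otherwise no run exceeds [N], the integer part of [X], and taking logarithms in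
    [success_tradeoff] contradicts the bound on [X]. The number [a] bounds [1 - delta] from below
    independently of [delta]. *)
Lemma many_queries (X a : R) :
  B = (n %/ m)%N -> 0 < a <= 1 - delta -> (2 * m%:R ^+ 2 / a ^+ 2) ^+ 2 <= n%:R ->
  0 <= X -> X < n%:R / (4 * m%:R * K) * ln (n%:R / delta) ->
  exists theta k, X <= k%:R /\ (0 < prob_queries_ge P A (M theta) k)%E.
Proof.
move=> Bnm /andP[a0 ad] nbig X0 Xlt; apply: contrapT => none.
have /andP[d0 d1] := delta01.
have BR : (0 : R) < B%:R by rewrite ltr0n.
have mR : (0 : R) < m%:R by rewrite ltr0n.
(* Rounding in [n %/ m] loses at most a factor 2. *)
have nB : n%:R <= 2 * m%:R * B%:R :> R.
  rewrite -!natrM ler_nat {1}(divn_eq n m) -Bnm.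
  have : (n %% m < m)%N by rewrite ltn_mod.
  by case: B B_gt0 => // B' _; nia.
have nR : (0 : R) < n%:R.
  by apply: lt_le_trans nbig; rewrite exprn_gt0// divr_gt0 ?exprn_gt0// mulr_gt0// exprn_gt0.
have nd0 : 0 < n%:R / delta by rewrite divr_gt0.
have /andP[tX Xt] := truncn_itv X0.
set N := Num.truncn X in tX Xt.
have H theta k : (N < k)%N -> prob_queries_ge P A (M theta) k = 0%E.
  move=> Nk; apply/eqP; rewrite eq_le; apply/andP; split; last first.
    apply: integral_ge0 => w _; rewrite lee_fin; apply: sumr_ge0 => h _.
    exact: transcript_prob_ge0.
  rewrite leNgt; apply/negP => pos; apply: none; exists theta, k; split => //.
  by apply: le_trans (ltW Xt) _; rewrite ler_nat.
have tr := success_tradeoff _ H.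
have ex : (1 + K / B%:R) ^+ N <= expR (K / B%:R * N%:R).
  rewrite expRM_natr lerXn2r ?nnegrE ?expR_ge0 ?expR_ge1Dx//.
  by rewrite addr_ge0// divr_ge0 ?ltW.
set E := expR _ in ex.
set beta := 2 * m%:R ^+ 2 / a ^+ 2 in nbig.
have b0 : 0 < beta by rewrite divr_gt0 ?exprn_gt0// mulr_gt0// exprn_gt0.
have Elow : n%:R / delta / beta <= E.
  apply: le_trans ex.
  rewrite ler_pdivrMr// ler_pdivrMr//.
  have -> : (1 + K / B%:R) ^+ N * beta * delta =
    (m%:R * delta * (1 + K / B%:R) ^+ N) * (2 * m%:R / a ^+ 2).
    by rewrite /beta; field; rewrite gt_eqF.
  apply: (@le_trans _ _ ((a ^+ 2 * B%:R) * (2 * m%:R / a ^+ 2))).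
    rewrite (_ : _ * _ = 2 * m%:R * B%:R)//; by field; rewrite gt_eqF.
  rewrite ler_wpM2r ?divr_ge0 ?mulr_ge0 ?(ltW a0) ?(ltW mR)//.
  apply: le_trans tr; rewrite ler_wpM2r ?(ltW BR)//.
  by rewrite lerXn2r// nnegrE ltW// (lt_le_trans a0).
(* Since [beta ^ 2 <= n <= n / delta], squaring absorbs the constant [beta]; the price is a factor 2
   in the exponent. *)
have E2 : n%:R / delta <= E ^+ 2.
  apply: (@le_trans _ _ ((n%:R / delta / beta) ^+ 2)); last first.
    by rewrite lerXn2r// nnegrE ?expR_ge0// ltW// divr_gt0.
  rewrite expr_div_n ler_pdivlMr ?exprn_gt0// [X in _ <= X]expr2 ler_wpM2l ?(ltW nd0)//.
  by apply: le_trans nbig _; rewrite ler_pdivlMr// ler_piMr// ltW.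
have L : ln (n%:R / delta) <= K / B%:R * N%:R * 2.
  rewrite -[leRHS]expRK expRM_natr ler_ln ?posrE ?exprn_gt0 ?expR_gt0//.
have := lt_le_trans Xlt (ler_wpM2l _ L).
rewrite ltNge => /(_ _)/negP; apply; first by rewrite divr_ge0 ?mulr_ge0 ?ltW.
apply: le_trans tX.
rewrite [leLHS](_ : _ = n%:R / (2 * m%:R * B%:R) * N%:R); last first.
  by field; rewrite !gt_eqF.
by rewrite ler_piMl// ler_pdivrMr ?mul1r// !mulr_gt0.
Qed.

End Hypotheses.

(** * Layout of the blocks and choice of the parameters *)

Lemma block_items (n m : nat) : (0 < m)%N ->
  exists item : 'I_(n %/ m) * 'I_m -> 'I_n, injective item.
Proof.
move=> m0.
have lt (u : 'I_(n %/ m) * 'I_m) : (u.1 * m + u.2 < n)%N.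
  have := leq_trunc_div n m; have := ltn_ord u.1; have := ltn_ord u.2.
  nia.
exists (fun u => Ordinal (lt u)) => -[b j] [b' j'] [] /= E.
have bb : b = b' :> nat.
  by have := congr1 (divn^~ m) E; rewrite !divnMDl// (divn_small (ltn_ord j)) (divn_small (ltn_ord j')) !addn0.
have jj : j = j' :> nat by move: E; rewrite bb; apply: addnI.
by congr pair; apply/val_inj.
Qed.

Lemma unlikely_items {R : realType} {n B m : nat} (item : 'I_B * 'I_m -> 'I_n) :
  injective item -> (0 < m)%N -> exists J : mnl R n -> 'I_B -> 'I_m, forall M b,
    choice_prob M [set item (b, j) | j : 'I_m] (item (b, J M b)) <= m%:R^-1.
Proof.
move=> item_inj m0.
have /choice[J HJ] : forall u : mnl R n * 'I_B, exists j,
    choice_prob u.1 [set item (u.2, j') | j' : 'I_m] (item (u.2, j)) <= m%:R^-1.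
  by move=> [M b]; exact: block_unlikely_item.
by exists (fun M b => J (M, b)) => M b; exact: (HJ (M, b)).
Qed.

Lemma queries_small_eps {R : realType} (n : nat) (eps delta a X : R)
    (d : measure_display) (Omega : measurableType d) (P : probability Omega R)
    (A : algorithm R n Omega) :
  0 < eps <= 8^-1 -> 0 < delta < 1 -> 0 < a <= 1 - delta ->
  (8 / a ^+ 2) ^+ 2 <= n%:R -> 0 <= X ->
  X < n%:R / (8 ^+ 3 * eps ^+ 2) * ln (n%:R / delta) ->
  (forall M : mnl R n, ((1 - delta)%:E <= prob_accurate P A M eps)%E) ->
  exists (M : mnl R n) k, X <= k%:R /\ (0 < prob_queries_ge P A M k)%E.
Proof.
move=> /andP[e0 e1] d01 a01 nbig X0 Xlt acc.
have a1 : a <= 1 by lra.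
have n2 : (2 <= n)%N.
  rewrite -(ler_nat R); apply: le_trans nbig.
  have /andP[a0 _] := a01.
  have : 1 <= (a ^+ 2)^-1 by rewrite invf_ge1 ?exprn_gt0// exprn_ile1 ?(ltW a0).
  by move: (_^-1) => y y1; nra.
have [item item_inj] := block_items n 2 isT.
have [J HJ] := unlikely_items (R := R) item item_inj isT.
(* For [m = 2] the gap is [2 * eps / (1 + 4 * eps)], which exceeds [eps] because [eps <= 1/8]. *)
pose kappa := 8 * eps; have k0 : 0 < kappa by rewrite mulr_gt0.
have [theta [k Hk]] : exists (theta : {ffun 'I_(n %/ 2) -> 'I_2}) k,
    X <= k%:R /\ (0 < prob_queries_ge P A (planted item kappa k0 theta) k)%E.
  apply: (@many_queries _ _ _ _ (planted item kappa k0) J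
    (fun theta b => likelihood_ratio item kappa theta b (rev_ord (theta b))) (kappa ^+ 2)
    _ _ _ _ _ _ _ _ P A eps delta _ _ _ _ X a) => //.
  - by rewrite divn_gt0.
  - by rewrite exprn_gt0.
  - by move=> *; exact: likelihood_ratio_gt0.
  - move=> theta b j S i jb S0.
    (* In ['I_2], the only index other than [theta b] is its reverse. *)
    rewrite (_ : rev_ord _ = j) -?likelihood_ratioE//.
    by apply/val_inj; move: jb => /=; case: j (theta b) => [[|[]]//= ?] [[|[]]//= ?].
  - by move=> theta S S0; exact: flip_ratio_mean.
  - exact: ltW.
  - move=> theta a'; apply: accurate_consistent => //.
    rewrite ltrBrDr ltr_pdivlMr ?addr_gt0// /kappa; nra.
  - by rewrite (_ : 2 * 2 ^+ 2 = 8)//; ring.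
  - by rewrite (_ : 4 * 2 * kappa ^+ 2 = 8 ^+ 3 * eps ^+ 2)// /kappa; ring.
by exists (planted item kappa k0 theta), k.
Qed.

Lemma queries_large_eps {R : realType} (m n : nat) (kappa eps delta a X : R)
    (d : measure_display) (Omega : measurableType d) (P : probability Omega R)
    (A : algorithm R n Omega) :
  (0 < m <= n)%N -> 0 < kappa -> 0 <= eps < (1 + kappa) / (m%:R + kappa) - m%:R^-1 ->
  0 < delta < 1 -> 0 < a <= 1 - delta -> (2 * m%:R ^+ 2 / a ^+ 2) ^+ 2 <= n%:R ->
  0 <= X ->
  X < n%:R / (4 * m%:R * (kappa * (2 + kappa))) * ln (n%:R / delta) ->
  (forall M : mnl R n, ((1 - delta)%:E <= prob_accurate P A M eps)%E) ->
  exists (M : mnl R n) k, X <= k%:R /\ (0 < prob_queries_ge P A M k)%E.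
Proof.
move=> /andP[m0 mn] k0 /andP[e0 gap] d01 a01 nbig X0 Xlt acc.
have [item item_inj] := block_items n m m0.
have [J HJ] := unlikely_items (R := R) item item_inj m0.
have [theta [k Hk]] : exists (theta : {ffun 'I_(n %/ m) -> 'I_m}) k,
    X <= k%:R /\ (0 < prob_queries_ge P A (planted item kappa k0 theta) k)%E.
  apply: (@many_queries _ _ _ _ (planted item kappa k0) J
    (crude_ratio item kappa) (kappa * (2 + kappa))
    _ _ _ _ _ _ _ _ P A eps delta _ _ _ _ X a) => //.
  - by rewrite divn_gt0.
  - by rewrite mulr_gt0// addr_gt0.
  - by move=> *; exact: crude_ratio_gt0.
  - by move=> *; exact: crude_ratio_dom.
  - by move=> *; exact: crude_ratio_mean.
  - by move=> theta a'; exact: accurate_consistent.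
by exists (planted item kappa k0 theta), k.
Qed.

Theorem theorem4p7 (R : realType) (eps1 delta1 : R)
    (heps1 : 0 < eps1 < 1) (hdelta1 : 0 < delta1 < 1) :
  exists (c : R) (n0 : nat), 0 < c /\
    forall (n : nat) (eps delta : R),
      (n0 <= n)%N -> 0 < eps <= eps1 -> 0 < delta <= delta1 ->
    forall (d : measure_display) (Omega : measurableType d)
      (P : probability Omega R) (A : algorithm R n Omega),
      (forall M : mnl R n, ((1 - delta)%:E <= prob_accurate P A M eps)%E) ->
    exists (M : mnl R n) (k : nat),
      c * (n%:R / eps ^+ 2 * ln (n%:R / delta)) <= k%:R /\
      (0 < prob_queries_ge P A M k)%E.
Proof.
have /andP[e10 e11] := heps1; have /andP[d10 d11] := hdelta1.
pose a := 1 - delta1; have a0 : 0 < a by rewrite subr_gt0.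
have g0 : 0 < 1 - eps1 by rewrite subr_gt0.
(* [m] and [kappa] are such that [1 / m] is below [(1 - eps1) / 2] and the special item has
   probability at least [1 - (1 - eps1) / 2]; the difference exceeds [eps1]. *)
pose m := (Num.truncn (2 / (1 - eps1))).+1.
have mR : (0 : R) < m%:R by rewrite ltr0n.
have mlarge : 2 / (1 - eps1) < m%:R.
  by have /andP[_] := truncn_itv (divr_ge0 (ler0n R 2) (ltW g0)).
pose kappa := 2 * m%:R / (1 - eps1).
have k0 : 0 < kappa by rewrite divr_gt0// mulr_gt0.
pose K := kappa * (2 + kappa); have K0 : 0 < K by rewrite mulr_gt0// addr_gt0.
have gap : eps1 < (1 + kappa) / (m%:R + kappa) - m%:R^-1.
  have m_inv : m%:R^-1 < (1 - eps1) / 2 by rewrite -[ltRHS]invf_div ltf_pV2 ?posrE ?divr_gt0.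
  have : 1 - (1 - eps1) / 2 <= (1 + kappa) / (m%:R + kappa).
    rewrite ler_pdivlMr ?addr_gt0//.
    have := divfK (lt0r_neq0 g0) (2 * m%:R); rewrite -/kappa.
    have := mulr_gt0 g0 mR; nra.
  lra.
pose b := (8 / a ^+ 2) ^+ 2 + (2 * m%:R ^+ 2 / a ^+ 2) ^+ 2 + m%:R.
have b1 : 0 <= (8 / a ^+ 2) ^+ 2 by exact: sqr_ge0.
have b2 : 0 <= (2 * m%:R ^+ 2 / a ^+ 2) ^+ 2 by exact: sqr_ge0.
(* One constant per regime. The power [8 ^ 4] in place of [8 ^ 3] gives the strict inequality for
   small [eps]; the second constant is [1 / (4 * m * K)] times half of [(1/8) ^ 2], and [eps > 1/8]
   in that regime. *)
pose c := Num.min (8 ^+ 4)^-1 (8 ^+ 3 * (m%:R * K))^-1.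
have c0 : 0 < c by rewrite lt_min !invr_gt0 exprn_gt0// mulr_gt0 ?exprn_gt0// mulr_gt0.
exists c, (Num.truncn b).+1; split=> // n eps delta nn0 /andP[e0 ee1] /andP[d0 dd1] d Omega P A acc.
have bn : b <= n%:R.
  apply: le_trans (_ : (Num.truncn b).+1%:R <= _); last by rewrite ler_nat.
  have /andP[_ /ltW//] := truncn_itv (addr_ge0 (addr_ge0 b1 b2) (ltW mR)).
have delta01 : 0 < delta < 1 by rewrite d0 (le_lt_trans dd1).
have a01 : 0 < a <= 1 - delta by rewrite a0 lerD2l lerN2.
have nR : 1 <= n%:R :> R by rewrite ler1n (leq_trans _ nn0).
have L0 : 0 < ln (n%:R / delta).
  by rewrite ln_gt0// ltr_pdivlMr// mul1r (lt_le_trans _ nR)//; case/andP: delta01.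
have X0 : 0 <= c * (n%:R / eps ^+ 2 * ln (n%:R / delta)).
  by rewrite !mulr_ge0 ?invr_ge0 ?exprn_ge0 ?(ltW c0) ?(ltW e0) ?(ltW L0).
have Xlt (q : R) : c < q * eps ^+ 2 ->
    c * (n%:R / eps ^+ 2 * ln (n%:R / delta)) < n%:R * q * ln (n%:R / delta).
  move=> cq; rewrite mulrA ltr_pM2r// mulrCA ltr_pM2l ?(lt_le_trans ltr01)//.
  by rewrite ltr_pdivrMr ?exprn_gt0.
have [e8|e8] := leP eps 8^-1.
  apply: (@queries_small_eps _ n eps delta a) => //; first by rewrite e0.
    by move: bn; rewrite /b; lra.
  apply: Xlt; rewrite invfM -mulrA mulVf ?expf_neq0 ?gt_eqF// mulr1.
  by rewrite gt_min; apply/orP; left; rewrite ltf_pV2 ?posrE ?exprn_gt0// ltr_eXn2l// ltr1n.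
apply: (@queries_large_eps _ m n kappa eps delta a) => //.
- by rewrite /= -(ler_nat R); move: bn; rewrite /b; lra.
- by rewrite (ltW e0) (le_lt_trans ee1).
- by move: bn; rewrite /b; lra.
- apply: Xlt; rewrite gt_min; apply/orP; right.
  rewrite -/K; have mK : 0 < m%:R * K by rewrite mulr_gt0.
  have -> : (8 ^+ 3 * (m%:R * K))^-1 = (4 * m%:R * K)^-1 * (8^-1 ^+ 2 / 2).
    by field; rewrite !gt_eqF.
  have q0 : 0 < (4 * m%:R * K)^-1 by rewrite invr_gt0 -mulrA mulr_gt0.
  rewrite ltr_pM2l//.
  apply: lt_trans _ (_ : 8^-1 ^+ 2 < _); last by rewrite ltrXn2r// ltW.
  by rewrite ltr_pdivrMr// ltr_pMr ?exprn_gt0 ?invr_gt0// ltr1n.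
Qed.
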